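(* Assume that for each task $q\in\mathcal{Q}$ not all agents are dominating for $q$. Let $\mathcal{G}_P$ be the partition game, and let $(\hat{\mathcal V}_1,\dots,\hat{\mathcal V}_n)\in(2^{\mathcal Q})^n$ be a strategy profile. Then $(\hat{\mathcal V}_1,\dots,\hat{\mathcal V}_n)$ is a Nash equilibrium of $\mathcal{G}_P$ if and only if both of the following hold: 1. for each $q\in\mathcal Q$ there exists $i\in\mathcal A$ dominating for $q$ with $q\in\hat{\mathcal V}_i$; 2. if $j\in\mathcal A$ is not a dominating agent for task $q\in\mathcal Q$, then $q\notin\hat{\mathcal V}_j$.
   Context: $\mathcal A=\{1,\dots,n\}$ is a finite set of agents and $\mathcal Q=\{1,\dots,m\}$ a finite set of tasks. For each $i\in\mathcal A$, $f_i:\mathcal Q\to\mathbb R_{\ge 0}$ is a given function ($f_i(q)=r_i(q)\phi_i(q)$, the product of a nonnegative reward and a nonnegative importance). Agent $i$ is dominating for task $q$ if $f_i(q)\ge f_j(q)$ for all $j\in\mathcal A$. A strategic form game $\langle\mathcal A,\{\mathcal S_i\},\{\psi_i\}\rangle$ consists of agents $\mathcal A$, strategy sets $\mathcal S_i$ and utilities $\psi_i:\prod_{k}\mathcal S_k\to\mathbb R$. A profile $(\hat s_i,\hat s_{-i})$ is a Nash equilibrium if $\psi_i(\hat s_i,\hat s_{-i})\ge\psi_i(s_i,\hat s_{-i})$ for all $s_i\in\mathcal S_i$ and all $i\in\mathcal A$, where $s_{-i}$ denotes the strategies of all agents other than $i$. The partition game is $\mathcal G_P=\langle\mathcal A,\{2^{\mathcal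 Q}\}_{i\in\mathcal A},\{H_i\}_{i\in\mathcal A}\rangle$: agent $i$ chooses a subset $\mathcal V_i\subseteq\mathcal Q$ (the subsets chosen need not form a partition) and has utility $$H_i(\mathcal V_i,\mathcal V_{-i})=\sum_{q\in\mathcal V_i}\Big[f_i(q)-\max_{j\in\mathcal A\setminus\{i\},\ q\in\mathcal V_j}f_j(q)\Big],$$ with the convention that the maximum over an empty index set is $0$. *)

(* Defs.v *)
From HB Require Import structures.
From mathcomp Require Import all_boot all_order all_algebra.
From mathcomp Require Import reals.

Set Implicit Arguments.
Unset Strict Implicit.
Unset Printing Implicit Defensive.

Import Order.TTheory GRing.Theory Num.Theory.
Local Open Scope ring_scope.

Record strategic_game (R : realType) (A : finType) := StrategicGame {
  strategy : A -> Type;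
  utility : A -> (forall k, strategy k) -> R
}.

(* [dfwith s t], with [t : strategy G i], is the profile (t, s_{-i}): agent i
   plays t and every other agent k plays s k. *)
Definition nash_equilibrium (R : realType) (A : finType)
    (G : strategic_game R A) (s : forall k, strategy G k) : Prop :=
  forall (i : A) (t : strategy G i), utility i (dfwith s t) <= utility i s.

Section PartitionGame.
Variables (R : realType) (n m : nat) (f : 'I_n -> 'I_m -> R).

Definition dominating (i : 'I_n) (q : 'I_m) : Prop :=
  forall j : 'I_n, f j q <= f i q.

(* The seed 0 gives the value on an empty index set; on a nonempty one this is
   the actual maximum as soon as f is nonnegative. *)
Definition max_others (i : 'I_n) (V : 'I_n -> {set 'I_m}) (q : 'I_m) : R :=
  \big[Num.max/0]_(j < n | (j != i) && (q \in V j)) f j q.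

Definition partition_utility (i : 'I_n) (V : 'I_n -> {set 'I_m}) : R :=
  \sum_(q in V i) (f i q - max_others i V q).

Definition partition_game : strategic_game R 'I_n :=
  @StrategicGame R 'I_n (fun _ => {set 'I_m}) partition_utility.

End PartitionGame.

(* Main.v *)
Require Import Defs.
From HB Require Import structures.
From mathcomp Require Import all_boot all_order all_algebra.
From mathcomp Require Import reals.
Import Order.TTheory GRing.Theory Num.Theory.
Local Open Scope ring_scope.

(** The utility of agent [i] is additive over tasks, and the marginal value
    [f i q - max_others f i V q] of a task depends only on the choices of the
    other agents.  So a best response takes every task of positive marginal
    value and none of negative marginal value, and the equilibrium condition
    decouples into one condition per agent and task ([nash_marginalP]):
    a holder of [q] is at least as good at [q] as every other holder, and an
    agent that does not hold [q] is no better than the best holder, or is worth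
    0 at [q] when nobody holds it.

    If every task is held by a dominating agent and only by such agents, both
    conditions are immediate.  Conversely, suppose that a non-dominating [j]
    holds [q], and let [i] dominate [q].  Then [f i q > f j q >= 0], so either
    [i] holds [q], or [i] is deterred by a holder as good as [i].  In both cases
    some other holder beats [j], contradicting the condition on holders.  Hence
    all holders dominate.  If [q] had no holder at all, then every agent [i]
    would have marginal value [f i q <= 0], hence would be worth 0 at [q], and
    all of them would dominate: this is the case that the hypothesis
    on tasks excludes. *)

(** Testing [t] against [S] with one element added or removed isolates the sign
    of a single [g q]; these tests suffice because the sum is additive. *)
Lemma subset_sum_maximalP (R : numDomainType) (T : finType) (g : T -> R)
    (S : {set T}) :
  (forall t : {set T}, \sum_(q in t) g q <= \sum_(q in S) g q) <->
  (forall q, if q \in S then 0 <= g q else g q <= 0).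
Proof.
split=> [Smax q | gS t].
  have [qS | qNS] := ifPn.
    by have := Smax (S :\ q); rewrite (big_setD1 _ qS) /= lerDr.
  by have := Smax (q |: S); rewrite big_setU1 //= gerDr.
rewrite big_mkcond [leRHS]big_mkcond; apply: ler_sum => q _.
by move: (gS q); case: (q \in S); case: (q \in t).
Qed.

Section Marginal.
Variables (R : realType) (n m : nat) (f : 'I_n -> 'I_m -> R).
Implicit Types (i j k : 'I_n) (q : 'I_m) (V : 'I_n -> {set 'I_m}).

Lemma max_others_deviation i V (t : {set 'I_m}) q :
  max_others f i (dfwith V (i := i) t) q = max_others f i V q.
Proof.
apply: eq_bigl => j; have [// | jNi] := eqVneq j i.
by rewrite dfwith_out // eq_sym.
Qed.

Lemma partition_utility_deviation i V (t : {set 'I_m}) :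
  partition_utility f i (dfwith V (i := i) t) =
  \sum_(q in t) (f i q - max_others f i V q).
Proof.
rewrite /partition_utility dfwith_in.
by apply: eq_bigr => q _; rewrite max_others_deviation.
Qed.

(** Against fixed choices of the others, an agent maximises a sum of fixed
    marginal values over a freely chosen set of tasks, so optimality is a sign
    condition on each marginal value. *)
Lemma nash_marginalP V :
  nash_equilibrium (G := partition_game f) V <->
  (forall i q, if q \in V i then max_others f i V q <= f i q
               else f i q <= max_others f i V q).
Proof.
split=> [nashV i q | marginalV i t].
  have /subset_sum_maximalP/(_ q) : forall t : {set 'I_m},
      \sum_(q in t) (f i q - max_others f i V q) <= partition_utility f i V.
    by move=> t; rewrite -partition_utility_deviation; apply: nashV.
  by rewrite subr_ge0 subr_le0.
rewrite /= partition_utility_deviation.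
move: t; apply/subset_sum_maximalP => q.
by rewrite subr_ge0 subr_le0; apply: marginalV.
Qed.

Lemma le_max_others i j V q :
  j != i -> q \in V j -> f j q <= max_others f i V q.
Proof.
by move=> jNi qVj; apply: le_bigmax_cond; apply/andP.
Qed.

(** The bound [0 <= x] comes from the value of the maximum on an empty index
    set. *)
Lemma max_others_leP i V q (x : R) :
  reflect (0 <= x /\ forall j, j != i -> q \in V j -> f j q <= x)
          (max_others f i V q <= x).
Proof.
apply: (iffP (bigmax_leP _ _ _ _)) => -[x_ge0 le_x]; split=> // j.
  by move=> jNi qVj; apply: le_x; apply/andP.
by case/andP; apply: le_x.
Qed.

Lemma exists_dominating (j : 'I_n) q : exists i, dominating f i q.
Proof.
have [i _ le_i] := arg_maxP (f^~ q) (erefl : xpredT j).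
by exists i => k; apply: le_i.
Qed.

Lemma dominatingP i q : reflect (dominating f i q) [forall j, f j q <= f i q].
Proof. exact: forallP. Qed.

Lemma not_dominating_lt i j q :
  dominating f i q -> ~ dominating f j q -> f j q < f i q.
Proof.
move=> dom_i ndom_j; rewrite ltNge; apply/negP => le_ij.
by apply: ndom_j => k; apply: le_trans le_ij.
Qed.

End Marginal.

Arguments exists_dominating {R n m} f j q.
Arguments dominatingP {R n m f i q}.

Theorem mainTheorem1 (R : realType) (n m : nat) (f : 'I_n -> 'I_m -> R)
    (f_ge0 : forall (i : 'I_n) (q : 'I_m), 0 <= f i q)
    (not_all_dominating :
       forall q : 'I_m, ~ (forall i : 'I_n, dominating f i q))
    (V : 'I_n -> {set 'I_m}) :
  nash_equilibrium (G := partition_game f) V <->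
  (forall q : 'I_m, exists i : 'I_n, dominating f i q /\ q \in V i) /\
  (forall (j : 'I_n) (q : 'I_m), ~ dominating f j q -> q \notin V j).
Proof.
rewrite nash_marginalP; split=> [nashV | [dom_holds holds_dom] i q]; last first.
  case: ifPn => [qVi | qNVi].
    apply/max_others_leP; split=> // j _ _.
    have [dom_i | ndom_i] := @dominatingP _ _ _ f i q; first exact: dom_i.
    by rewrite (negPf (holds_dom _ _ ndom_i)) in qVi.
  have [k [dom_k qVk]] := dom_holds q.
  apply: le_trans (dom_k i) _; apply: le_max_others => //.
  by apply: contraNneq qNVi => <-.
have holds_dom j q : ~ dominating f j q -> q \notin V j.
  move=> ndom_j; apply/negP => qVj.
  have := nashV j q; rewrite qVj => /max_others_leP[_ others_le].
  have [i dom_i] := exists_dominating f j q.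
  have lt_ji : f j q < f i q by apply: not_dominating_lt.
  have holder_le k : q \in V k -> f k q <= f j q.
    by have [-> // | kNj] := eqVneq k j; apply: others_le.
  have := nashV i q; case: ifPn => [qVi _ | _ deterred].
    by have := holder_le i qVi; rewrite leNgt lt_ji.
  suff le_ij : max_others f i V q <= f j q.
    by have := le_trans deterred le_ij; rewrite leNgt lt_ji.
  by apply/max_others_leP; split=> // k _; apply: holder_le.
split=> // q.
have [/existsP[i qVi] | /existsPn unheld] := boolP [exists i, q \in V i].
  exists i; split=> //; have [// | ndom_i] := @dominatingP _ _ _ f i q.
  by rewrite (negPf (holds_dom _ _ ndom_i)) in qVi.
case: (not_all_dominating q) => i j.
have := nashV j q; rewrite (negPf (unheld j)) => /le_trans; apply.
by apply/max_others_leP; split=> // k _; rewrite (negPf (unheld k)).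
Qed.
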